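(* Let $(H,\alpha)$ be a monoidal Hom-Hopf algebra and let $A\subset B$ be a right $H$-extension, that is, $(B,\beta)$ is a right $(H,\alpha)$-Hom-comodule algebra and $A=B^{coH}$. Then the following are equivalent: (1) $A\subset B$ is $H$-cleft; (2) $A\subset B$ is $H$-Galois and has the normal base property.
   Context: All vector spaces, tensor products and linear maps are over a fixed field $k$. Sweedler notation: $\Delta(h)=\sum h_1\otimes h_2$. A Hom-algebra $(A,\beta)$ is a vector space $A$ with a linear automorphism $\beta$, an element $1\in A$ and a linear map $A\otimes A\to A$, $a\otimes b\mapsto ab$, such that $\beta(a)(bc)=(ab)\beta(c)$, $a1=\beta(a)=1a$, $\beta(ab)=\beta(a)\beta(b)$, $\beta(1)=1$. A Hom-algebra map is a linear map commuting with the automorphisms and preserving products and identities. The tensor product of Hom-algebras is a Hom-algebra with componentwise product and the tensor product automorphism. A Hom-coalgebra $(C,\gamma)$ is a vector space with a linear automorphism $\gamma$ and linear maps $\Delta:C\to C\otimes C$, $\varepsilon:C\to k$ such that $\sum\gamma^{-1}(c_1)\otimes\Delta(c_2)=\sum\Delta(c_1)\otimes\gamma^{-1}(c_2)$, $\sum c_1\varepsilon(c_2)=\sum\varepsilon(c_1)c_2=\gamma^{-1}(c)$, $\Delta(\gamma(c))=\sum\gamma(c_1)\otimes\gamma(c_2)$, $\varepsilon(\gamma(c))=\varepsilon(c)$. A monoidal Hom-Hopf algebra $(H,\alpha)$ is a vector space with linear automorphism $\alpha$ that is both a Hom-algebra and a Hom-coalgebra, with $\Delta(gh)=\Delta(g)\Delta(h)$,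 $\Delta(1)=1\otimes1$, $\varepsilon(gh)=\varepsilon(g)\varepsilon(h)$, $\varepsilon(1)=1$, and with a linear map $S:H\to H$ such that $S\circ\alpha=\alpha\circ S$ and $\sum S(h_1)h_2=\varepsilon(h)1=\sum h_1S(h_2)$. A left $(A,\beta)$-Hom-module is a vector space $M$ with linear automorphism $\mu$ and a linear map $A\otimes M\to M$, $a\otimes m\mapsto am$, with $\beta(a)(bm)=(ab)\mu(m)$, $1m=\mu(m)$, $\mu(am)=\beta(a)\mu(m)$; right Hom-modules are defined similarly. Left $A$-module maps are linear maps commuting with the action and with the automorphisms. A right $(H,\alpha)$-Hom-comodule is a vector space $M$ with linear automorphism $\mu$ and a linear map $\rho:M\to M\otimes H$, $m\mapsto\sum m_{(0)}\otimes m_{(1)}$, with $\sum\mu^{-1}(m_{(0)})\otimes\Delta(m_{(1)})=\sum\rho(m_{(0)})\otimes\alpha^{-1}(m_{(1)})$, $\sum\varepsilon(m_{(1)})m_{(0)}=\mu^{-1}(m)$, $\rho(\mu(m))=\sum\mu(m_{(0)})\otimes\alpha(m_{(1)})$. Right $H$-comodule maps $g:M\to N$ are linear maps commuting with the automorphisms and satisfying $\rho_N\circ g=(g\otimes id)\circ\rho_M$. $H$ is a right $H$-comodule via $\Delta$. A right $(H,\alpha)$-Hom-comodule algebra is a Hom-algebra $(B,\beta)$ with a right $(H,\alpha)$-Hom-comodule structure $\rho:B\to B\otimes H$ that is a Hom-algebra map. Its coinvariants are $B^{coH}=\{b\in B:\rho(b)=\beta^{-1}(b)\otimes 1\}$,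 a Hom-algebra with the restriction of $\beta$; $B$ is a left and right $A=B^{coH}$-module by multiplication. Cleft: $A=B^{coH}\subset B$ is $H$-cleft if there is a right $H$-comodule map $\gamma:H\to B$ which is convolution invertible, i.e. there is a linear $\gamma^{-1}:H\to B$ with $\sum\gamma(h_1)\gamma^{-1}(h_2)=\varepsilon(h)1=\sum\gamma^{-1}(h_1)\gamma(h_2)$. Tensor product over $A$: for a right Hom-module $(M,\mu)$ and left Hom-module $(N,\lambda)$ over $A$, $M\otimes_AN$ is the quotient of $M\otimes N$ by the subspace spanned by all $m\cdot a\otimes n-\mu(m)\otimes a\cdot\lambda^{-1}(n)$, $m\in M$, $n\in N$, $a\in A$. Galois: $A=B^{coH}\subset B$ is (right) $H$-Galois if the linear map $\varphi:B\otimes_AB\to B\otimes H$, $\varphi(a\otimes b)=\sum\beta^{-1}(a)b_{(0)}\otimes\alpha(b_{(1)})$, is bijective. Normal base property: $A\subset B$ has the normal base property if $B\cong A\otimes H$ as left $A$-modules and right $H$-comodules (a single isomorphism which is both a left $A$-module map and a right $H$-comodule map), where $A\otimes H$ has automorphism $\beta\otimes\alpha$, left action $a\cdot(b\otimes h)=\beta^{-1}(a)b\otimes\alpha(h)$ and right coaction $a\otimes h\mapsto\sum(\beta^{-1}(a)\otimes h_1)\otimes\alpha(h_2)$. *)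

(* Defs.v *)
From HB Require Import structures.
From mathcomp Require Import all_boot all_algebra.
From mathcomp Require Import boolp.
From mathcomp Require Import freeg.

Set Implicit Arguments.
Unset Strict Implicit.
Unset Printing Implicit Defensive.

Import GRing.Theory.
Local Open Scope ring_scope.
Local Open Scope quotient_scope.

Section LinearSpan.
Variables (k : fieldType) (V : lmodType k) (S : V -> Prop).

Inductive lspan : V -> Prop :=
| lspan0 : lspan 0
| lspanZD a u v : S u -> lspan v -> lspan (a *: u + v).

Lemma lspan_gen u : S u -> lspan u.
Proof. by move=> Su; rewrite -[u]addr0 -[u]scale1r; apply: lspanZD (lspan0). Qed.

Lemma lspanD u v : lspan u -> lspan v -> lspan (u + v).
Proof.
move=> su sv; elim: su => [|a u' w Su' _ IH]; first by rewrite add0r.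
by rewrite -addrA; apply: lspanZD.
Qed.

Lemma lspanZ a u : lspan u -> lspan (a *: u).
Proof.
elim=> [|b u' w Su' _ IH]; first by rewrite scaler0; apply: lspan0.
by rewrite scalerDr scalerA; apply: lspanZD.
Qed.

Lemma lspanN u : lspan u -> lspan (- u).
Proof. by rewrite -scaleN1r; apply: lspanZ. Qed.

Definition lquot_rel (u v : V) : bool := `[< lspan (u - v) >].

Lemma lquot_rel_refl : reflexive lquot_rel.
Proof. by move=> u; apply/asboolP; rewrite subrr; apply: lspan0. Qed.

Lemma lquot_rel_sym : symmetric lquot_rel.
Proof.
suff sub u v : lquot_rel u v -> lquot_rel v u by move=> u v; apply/idP/idP => /sub.
by move=> /asboolP/lspanN; rewrite opprB => ?; apply/asboolP.
Qed.

Lemma lquot_rel_trans : transitive lquot_rel.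
Proof.
move=> v u w /asboolP suv /asboolP svw; apply/asboolP.
by rewrite -(subrK v u) -addrA; apply: lspanD.
Qed.

Canonical lquot_equiv :=
  EquivRel lquot_rel lquot_rel_refl lquot_rel_sym lquot_rel_trans.

(* The quotient of V by the linear span of S. *)
Definition lquot : Type := {eq_quot lquot_rel}.

HB.instance Definition _ := Choice.on lquot.
HB.instance Definition _ := EqQuotient.on lquot.

Definition qproj (v : V) : lquot := \pi_lquot v.

Lemma qproj_eq u v : lspan (u - v) -> qproj u = qproj v.
Proof. by move=> suv; apply/eqmodP; apply/asboolP. Qed.

Lemma qproj_repr (x : lquot) : qproj (repr x) = x.
Proof. exact: reprK. Qed.

Lemma lspan_repr v : lspan (repr (qproj v) - v).
Proof.
have : repr (qproj v) = v %[mod lquot] by rewrite reprK.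
by move=> /eqmodP/asboolP.
Qed.

Definition lquot_add (x y : lquot) := qproj (repr x + repr y).
Definition lquot_opp (x : lquot) := qproj (- repr x).
Definition lquot_scale a (x : lquot) := qproj (a *: repr x).

Lemma qprojD u v : lquot_add (qproj u) (qproj v) = qproj (u + v).
Proof.
by apply: qproj_eq; rewrite opprD addrACA; apply: lspanD; apply: lspan_repr.
Qed.

Lemma qprojN u : lquot_opp (qproj u) = qproj (- u).
Proof. by apply: qproj_eq; rewrite -opprD; apply: lspanN; apply: lspan_repr. Qed.

Lemma qprojZ a u : lquot_scale a (qproj u) = qproj (a *: u).
Proof. by apply: qproj_eq; rewrite -scalerBr; apply: lspanZ; apply: lspan_repr. Qed.

Lemma lquot_addA : associative lquot_add.
Proof.
move=> x y z; rewrite -[x]qproj_repr -[y]qproj_repr -[z]qproj_repr.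
by rewrite !qprojD addrA.
Qed.

Lemma lquot_addC : commutative lquot_add.
Proof. by move=> x y; rewrite /lquot_add addrC. Qed.

Lemma lquot_add0 : left_id (qproj 0) lquot_add.
Proof. by move=> x; rewrite -[x]qproj_repr qprojD add0r. Qed.

Lemma lquot_addN : left_inverse (qproj 0) lquot_opp lquot_add.
Proof. by move=> x; rewrite -[x]qproj_repr qprojN qprojD addNr. Qed.

HB.instance Definition _ :=
  GRing.isZmodule.Build lquot lquot_addA lquot_addC lquot_add0 lquot_addN.

Lemma lquot_scaleA a b x :
  lquot_scale a (lquot_scale b x) = lquot_scale (a * b) x.
Proof. by rewrite -[x]qproj_repr !qprojZ scalerA. Qed.

Lemma lquot_scale1 : left_id 1 lquot_scale.
Proof. by move=> x; rewrite -[x]qproj_repr qprojZ scale1r. Qed.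

Lemma lquot_scaleDr : right_distributive lquot_scale +%R.
Proof.
move=> a x y; rewrite -[x]qproj_repr -[y]qproj_repr.
by rewrite [X in lquot_scale _ X]qprojD !qprojZ [RHS]qprojD scalerDr.
Qed.

Lemma lquot_scaleDl x : {morph lquot_scale^~ x : a b / a + b}.
Proof.
move=> a b; rewrite -[x]qproj_repr !qprojZ.
by rewrite [RHS]qprojD scalerDl.
Qed.

HB.instance Definition _ := GRing.Zmodule_isLmodule.Build k lquot
  lquot_scaleA lquot_scale1 lquot_scaleDr lquot_scaleDl.

Lemma qproj_is_linear : linear qproj.
Proof. by move=> a u v; rewrite [X in _ = X + _]qprojZ [RHS]qprojD. Qed.

HB.instance Definition _ :=
  GRing.isLinear.Build k V lquot _ qproj qproj_is_linear.

(* The map out of the quotient induced by f; meaningful when f kills S. *)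
Definition qlift (P : lmodType k) (f : V -> P) (x : lquot) : P := f (repr x).

Lemma qlift_wd (P : lmodType k) (f : {linear V -> P}) :
  (forall u, S u -> f u = 0) -> forall u v, lspan (u - v) -> f u = f v.
Proof.
move=> fS u v suv; apply/eqP; rewrite -subr_eq0 -linearB; apply/eqP.
elim: suv => [|a u' w Su' _ IH]; first by rewrite linear0.
by rewrite linearP fS // scaler0 add0r.
Qed.

Lemma qliftE (P : lmodType k) (f : {linear V -> P}) :
  (forall u, S u -> f u = 0) -> forall v, qlift f (qproj v) = f v.
Proof. by move=> fS v; apply: qlift_wd fS _ _ (lspan_repr v). Qed.

Lemma qlift_linear (P : lmodType k) (f : {linear V -> P}) :
  (forall u, S u -> f u = 0) -> linear (qlift f).
Proof.
move=> fS a x y; rewrite -[x]qproj_repr -[y]qproj_repr -linearP.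
by rewrite !qliftE // linearP.
Qed.

End LinearSpan.

Section FreeModule.
Variables (k : fieldType) (K : choiceType) (P : lmodType k) (f : K -> P).

Lemma fglift_linear : linear (fglift f : {freeg K / k} -> P).
Proof.
pose g : {additive {freeg K / k} -> P} := HB.pack (fglift f : {freeg K / k} -> P)
  (GRing.isAdditive.Build {freeg K / k} P (fglift f) (lift_is_additive f)).
have gZ a (D : {freeg K / k}) : g (a *: D) = a *: g D.
  have -> : a *: D = \sum_(x <- dom D) << a * coeff x D *g x >> by [].
  rewrite (raddf_sum g) -[in RHS](freeg_sumE D) (raddf_sum g) scaler_sumr.
  apply: eq_bigr => x _; rewrite [LHS]liftU -scalerA; congr (_ *: _).
  by rewrite [RHS]liftU.
by move=> a D E; rewrite -[RHS]/(a *: g D + g E) -gZ -raddfD.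
Qed.

HB.instance Definition _ := GRing.isLinear.Build k {freeg K / k} P _
  (fglift f) fglift_linear.

End FreeModule.

Notation bilinear_map f := (bilinear_for *:%R *:%R f).

(* The tensor product of vector spaces: the free vector space on M * N modulo
   the bilinearity relations. *)
Section Tensor.
Variables (k : fieldType) (M N : lmodType k).

Local Notation F := {freeg (M * N)%type / k}.
Local Notation gen m n := (<< (m, n) >> : F).

Inductive tensor_rel : F -> Prop :=
| TensorDl m m' n : tensor_rel (gen (m + m') n - (gen m n + gen m' n))
| TensorDr m n n' : tensor_rel (gen m (n + n') - (gen m n + gen m n'))
| TensorZl a m n : tensor_rel (gen (a *: m) n - a *: gen m n)
| TensorZr a m n : tensor_rel (gen m (a *: n) - a *: gen m n).

Definition tensor : Type := lquot tensor_rel.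

HB.instance Definition _ := GRing.Lmodule.on tensor.

Definition tens (m : M) (n : N) : tensor := qproj tensor_rel (gen m n).

Lemma tensDl m m' n : tens (m + m') n = tens m n + tens m' n.
Proof.
by rewrite /tens -linearD; apply/qproj_eq/lspan_gen; apply: TensorDl.
Qed.

Lemma tensDr m n n' : tens m (n + n') = tens m n + tens m n'.
Proof.
by rewrite /tens -linearD; apply/qproj_eq/lspan_gen; apply: TensorDr.
Qed.

Lemma tensZl a m n : tens (a *: m) n = a *: tens m n.
Proof.
by rewrite /tens -linearZ; apply/qproj_eq/lspan_gen; apply: TensorZl.
Qed.

Lemma tensZr a m n : tens m (a *: n) = a *: tens m n.
Proof.
by rewrite /tens -linearZ; apply/qproj_eq/lspan_gen; apply: TensorZr.
Qed.

Lemma tens0l n : tens 0 n = 0.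
Proof. by rewrite -(scale0r 0) tensZl scale0r. Qed.

Lemma tens0r m : tens m 0 = 0.
Proof. by rewrite -(scale0r 0) tensZr scale0r. Qed.

Lemma tens_bilinear : bilinear_map tens.
Proof. by split=> z a x y; rewrite ?tensDl ?tensDr ?tensZl ?tensZr. Qed.

Lemma tens_ind (Q : tensor -> Prop) :
    (forall m n, Q (tens m n)) -> (forall x y, Q x -> Q y -> Q (x + y)) ->
  forall x, Q x.
Proof.
move=> Qt QD x; rewrite -[x]qproj_repr -[repr x]freeg_sumE linear_sum.
elim: (dom _) => [|[m n] s IH]; first by rewrite big_nil -(scale0r (tens 0 0)) -tensZl.
rewrite big_cons; apply: QD IH; move=> /=.
have -> // : qproj tensor_rel << coeff (m, n) (repr x) *g (m, n) >>
    = tens (coeff (m, n) (repr x) *: m) n.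
rewrite tensZl /tens -linearZ; congr (qproj _ _).
apply/eqP/freeg_eqP => z.
by rewrite coeffZ !coeffU mul1r.
Qed.

Section Lift.
Variable P : lmodType k.

(* The map out of the tensor product induced by f; meaningful when f is
   bilinear. *)
Definition tlift (f : M -> N -> P) : tensor -> P :=
  qlift (fglift (fun p : M * N => f p.1 p.2)).

Lemma tlift_kills (f : M -> N -> P) : bilinear_map f ->
  forall u, tensor_rel u -> fglift (fun p : M * N => f p.1 p.2) u = 0.
Proof.
move=> [fl fr] u ru; apply/eqP; case: ru => [m m' n|m n n'|a m n|a m n];
  rewrite linearB subr_eq0 ?linearD ?linearZ_LR /= !liftU !scale1r /=; apply/eqP.
- by have := fl n 1 m m'; rewrite /= !scale1r => ->.
- by have := fr m 1 n n'; rewrite /= !scale1r => ->.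
- have f0 : f 0 n = 0.
    by have := fl n (-1) 0 0; rewrite /= scaler0 addr0 scaleN1r addNr.
  by have := fl n a m 0; rewrite /= !addr0 f0 addr0 => ->.
- have f0 : f m 0 = 0.
    by have := fr m (-1) 0 0; rewrite /= scaler0 addr0 scaleN1r addNr.
  by have := fr m a n 0; rewrite /= !addr0 f0 addr0 => ->.
Qed.

Lemma tlift_linear (f : M -> N -> P) : bilinear_map f -> linear (tlift f).
Proof. by move=> fb; apply/qlift_linear/tlift_kills. Qed.

Lemma tliftE (f : M -> N -> P) :
  bilinear_map f -> forall m n, tlift f (tens m n) = f m n.
Proof.
move=> fb m n; rewrite [LHS]qliftE; last exact: tlift_kills.
by rewrite /= liftU scale1r.
Qed.

Lemma tliftD (f : M -> N -> P) : bilinear_map f -> {morph tlift f : x y / x + y}.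
Proof. by move=> /tlift_linear fl x y; have := fl 1 x y; rewrite /= !scale1r. Qed.

Lemma tlift_param (Q : lmodType k) (f : Q -> M -> N -> P) :
    (forall q, bilinear_map (f q)) ->
    (forall m n, linear (fun q => f q m n)) ->
  forall x, linear (fun q => tlift (f q) x).
Proof.
move=> fb fq x a u v; elim/tens_ind: x => [m n|x y IHx IHy].
  by rewrite /= !tliftE //; apply: fq.
by rewrite /= !tliftD //= IHx IHy scalerDr addrACA.
Qed.

End Lift.
End Tensor.

Notation "x \ot y" := (tens x y) (at level 40, left associativity) : ring_scope.

Section TensorMap.
Variables (k : fieldType) (M N M' N' : lmodType k).

Definition tmap (f : M -> M') (g : N -> N') : tensor M N -> tensor M' N' :=
  tlift (fun m n => f m \ot g n).

Lemma tmap_bilinear (f : {linear M -> M'}) (g : {linear N -> N'}) :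
  bilinear_map (fun m n => f m \ot g n).
Proof.
by split=> z a x y; rewrite linearP ?tensDl ?tensDr ?tensZl ?tensZr.
Qed.

Lemma tmap_linear (f : {linear M -> M'}) (g : {linear N -> N'}) :
  linear (tmap f g).
Proof. exact/tlift_linear/tmap_bilinear. Qed.

HB.instance Definition _ (f : {linear M -> M'}) (g : {linear N -> N'}) :=
  GRing.isLinear.Build k (tensor M N) (tensor M' N') _ (tmap f g)
    (tmap_linear f g).

Lemma tmapE (f : {linear M -> M'}) (g : {linear N -> N'}) m n :
  tmap f g (m \ot n) = f m \ot g n.
Proof. exact/tliftE/tmap_bilinear. Qed.

End TensorMap.

Section TensorAssoc.
Variables (k : fieldType) (M N P : lmodType k).

Definition tassoc : tensor (tensor M N) P -> tensor M (tensor N P) :=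
  tlift (fun x p => tlift (fun m n => m \ot (n \ot p)) x).

Lemma tassoc_bilinear2 (p : P) :
  bilinear_map (fun (m : M) (n : N) => m \ot (n \ot p)).
Proof. by split=> z a x y; rewrite !(tensDl, tensDr, tensZl, tensZr). Qed.

Lemma tassoc_bilinear : bilinear_map (fun (x : tensor M N) (p : P) =>
  tlift (fun m n => m \ot (n \ot p)) x).
Proof.
split=> [p|x]; first exact/tlift_linear/tassoc_bilinear2.
apply: (tlift_param (f := fun p m n => m \ot (n \ot p))) => [p|m n a p p'].
  exact: tassoc_bilinear2.
by rewrite !(tensDr, tensZr).
Qed.

HB.instance Definition _ := GRing.isLinear.Build k _ _ _ tassoc
  (tlift_linear tassoc_bilinear).

Lemma tassocE m n p : tassoc (m \ot n \ot p) = m \ot (n \ot p).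
Proof.
by rewrite /tassoc tliftE ?tliftE //;
  [exact: tassoc_bilinear2 | exact: tassoc_bilinear].
Qed.

End TensorAssoc.

(* Vector space with a linear automorphism hauto; its inverse hautoV, which is
   determined by hauto, is kept as a field. *)
HB.mixin Record hasHomAutomorphism (k : fieldType) V of GRing.Lmodule k V := {
  hauto : V -> V;
  hautoV : V -> V;
  hauto_is_linear : linear hauto;
  hautoK : cancel hauto hautoV;
  hautoVK : cancel hautoV hauto
}.

#[short(type="homSpaceType")]
HB.structure Definition HomSpace (k : fieldType) :=
  {V of GRing.Lmodule k V & hasHomAutomorphism k V}.

Section HomSpaceTheory.
Variables (k : fieldType) (V : homSpaceType k).

HB.instance Definition _ :=
  GRing.isLinear.Build k V V _ (@hauto k V) hauto_is_linear.

Lemma hautoV_is_linear : linear (@hautoV k V).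
Proof. exact: (can2_linear (@hautoK k V) (@hautoVK k V)). Qed.

HB.instance Definition _ :=
  GRing.isLinear.Build k V V _ (@hautoV k V) hautoV_is_linear.

End HomSpaceTheory.

Section TensorHomSpace.
Variables (k : fieldType) (M N : homSpaceType k).

Lemma tauto_is_linear :
  linear (tmap hauto hauto : tensor M N -> tensor M N).
Proof. exact: linearP. Qed.

Lemma tautoK : cancel (tmap hauto hauto : tensor M N -> tensor M N)
                      (tmap hautoV hautoV).
Proof.
elim/tens_ind => [m n|x y IHx IHy]; last by rewrite !linearD /= IHx IHy.
by rewrite !tmapE /= !hautoK.
Qed.

Lemma tautoVK : cancel (tmap hautoV hautoV)
                       (tmap hauto hauto : tensor M N -> tensor M N).
Proof.
elim/tens_ind => [m n|x y IHx IHy]; last by rewrite !linearD /= IHx IHy.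
by rewrite !tmapE /= !hautoVK.
Qed.

HB.instance Definition _ := hasHomAutomorphism.Build k (tensor M N)
  tauto_is_linear tautoK tautoVK.

Lemma hauto_tens (m : M) (n : N) : hauto (m \ot n) = hauto m \ot hauto n.
Proof. exact: tmapE. Qed.

Lemma hautoV_tens (m : M) (n : N) : hautoV (m \ot n) = hautoV m \ot hautoV n.
Proof. exact: tmapE. Qed.

End TensorHomSpace.

HB.mixin Record isHomAlgebra (k : fieldType) A of HomSpace k A := {
  hmul : A -> A -> A;
  hone : A;
  hmul_bilinear : bilinear_map hmul;
  hmulA : forall a b c, hmul (hauto a) (hmul b c) = hmul (hmul a b) (hauto c);
  hmulr1 : forall a, hmul a hone = hauto a;
  hmul1r : forall a, hmul hone a = hauto a;
  hautoM : forall a b, hauto (hmul a b) = hmul (hauto a) (hauto b);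
  hauto1 : hauto hone = hone
}.

#[short(type="homAlgType")]
HB.structure Definition HomAlgebra (k : fieldType) :=
  {A of HomSpace k A & isHomAlgebra k A}.

Notation "a ** b" := (hmul a b) (at level 40, left associativity) : ring_scope.
Notation "\1" := (hone) (at level 0) : ring_scope.

Section HomAlgebraTheory.
Variables (k : fieldType) (A : homAlgType k).
Implicit Types a b c : A.

Lemma hmulDl a b c : (a + b) ** c = a ** c + b ** c.
Proof. by have := hmul_bilinear.1 c 1 a b; rewrite /= !scale1r. Qed.
Lemma hmulDr a b c : a ** (b + c) = a ** b + a ** c.
Proof. by have := hmul_bilinear.2 a 1 b c; rewrite /= !scale1r. Qed.
Lemma hmul0l a : 0 ** a = 0.
Proof. by have := hmul_bilinear.1 a (-1) 0 0; rewrite /= scaler0 addr0 scaleN1r addNr. Qed.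
Lemma hmul0r a : a ** 0 = 0.
Proof. by have := hmul_bilinear.2 a (-1) 0 0; rewrite /= scaler0 addr0 scaleN1r addNr. Qed.
Lemma hmulZl x a b : (x *: a) ** b = x *: (a ** b).
Proof. by have := hmul_bilinear.1 b x a 0; rewrite /= hmul0l !addr0. Qed.
Lemma hmulZr x a b : a ** (x *: b) = x *: (a ** b).
Proof. by have := hmul_bilinear.2 a x b 0; rewrite /= hmul0r !addr0. Qed.
Lemma hautoV1 : hautoV \1 = \1 :> A.
Proof. by rewrite -[in LHS]hauto1 hautoK. Qed.
Lemma hautoVM a b : hautoV (a ** b) = hautoV a ** hautoV b.
Proof. by rewrite -{1}[a]hautoVK -{1}[b]hautoVK -hautoM hautoK. Qed.

End HomAlgebraTheory.

Section TensorHomAlgebra.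
Variables (k : fieldType) (A B : homAlgType k).

(* (a \ot b)(c \ot d) = ac \ot bd; see tmulE. *)
Definition tmul (x y : tensor A B) : tensor A B :=
  tlift (fun c d => tlift (fun a b => (a ** c) \ot (b ** d)) x) y.

Lemma tmul_bil1 (c : A) (d : B) :
  bilinear_map (fun a b => (a ** c) \ot (b ** d)).
Proof.
by split=> z r x y /=; rewrite ?(hmulDl, hmulZl) ?(tensDl, tensDr, tensZl, tensZr).
Qed.

Lemma tmul_bil2 (x : tensor A B) :
  bilinear_map (fun c d => tlift (fun a b => (a ** c) \ot (b ** d)) x).
Proof.
split=> [d|c].
  apply: (tlift_param (f := fun c a b => (a ** c) \ot (b ** d))) => [c|a b r c c'].
    exact: tmul_bil1.
  by rewrite hmulDr hmulZr tensDl tensZl.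
apply: (tlift_param (f := fun d a b => (a ** c) \ot (b ** d))) => [d|a b r d d'].
  exact: tmul_bil1.
by rewrite hmulDr hmulZr tensDr tensZr.
Qed.

Lemma tmulE a b c d : tmul (a \ot b) (c \ot d) = (a ** c) \ot (b ** d).
Proof. by rewrite /tmul (tliftE (tmul_bil2 _)) (tliftE (tmul_bil1 _ _)). Qed.

Lemma tmul_bilinear : bilinear_map tmul.
Proof.
split=> [y|x]; last exact: tlift_linear (tmul_bil2 x).
apply: (tlift_param
  (f := fun x c d => tlift (fun a b => (a ** c) \ot (b ** d)) x)) => [x|c d].
  exact: tmul_bil2.
exact: tlift_linear (tmul_bil1 c d).
Qed.

Lemma tmulDl x y z : tmul (x + y) z = tmul x z + tmul y z.
Proof. by have := tmul_bilinear.1 z 1 x y; rewrite /= !scale1r. Qed.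
Lemma tmulDr x y z : tmul x (y + z) = tmul x y + tmul x z.
Proof. by have := tmul_bilinear.2 x 1 y z; rewrite /= !scale1r. Qed.

Lemma tmulA x y z : tmul (hauto x) (tmul y z) = tmul (tmul x y) (hauto z).
Proof.
elim/tens_ind: x => [a b|x x' IH IH']; last by rewrite linearD !tmulDl IH IH'.
elim/tens_ind: y => [c d|y y' IH IH']; last by rewrite !(tmulDl, tmulDr) IH IH'.
elim/tens_ind: z => [e f|z z' IH IH']; last by rewrite linearD !tmulDr IH IH'.
by rewrite !hauto_tens !tmulE !hmulA.
Qed.

Lemma tmulr1 x : tmul x (\1 \ot \1) = hauto x.
Proof.
elim/tens_ind: x => [a b|x x' IH IH']; last by rewrite linearD tmulDl IH IH'.
by rewrite hauto_tens tmulE !hmulr1.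
Qed.

Lemma tmul1r x : tmul (\1 \ot \1) x = hauto x.
Proof.
elim/tens_ind: x => [a b|x x' IH IH']; last by rewrite linearD tmulDr IH IH'.
by rewrite hauto_tens tmulE !hmul1r.
Qed.

Lemma tautoM x y : hauto (tmul x y) = tmul (hauto x) (hauto y).
Proof.
elim/tens_ind: x => [a b|x x' IH IH']; last by rewrite !(linearD, tmulDl) /= IH IH'.
elim/tens_ind: y => [c d|y y' IH IH']; last by rewrite !(linearD, tmulDr) /= IH IH'.
by rewrite !hauto_tens !tmulE hauto_tens !hautoM.
Qed.

Lemma tauto1 : hauto (\1 \ot \1) = \1 \ot \1 :> tensor A B.
Proof. by rewrite hauto_tens !hauto1. Qed.

HB.instance Definition _ := isHomAlgebra.Build k (tensor A B)
  tmul_bilinear tmulA tmulr1 tmul1r tautoM tauto1.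

Lemma hmul_tens (a c : A) (b d : B) :
  (a \ot b) ** (c \ot d) = (a ** c) \ot (b ** d).
Proof. exact: tmulE. Qed.

End TensorHomAlgebra.

(* The two sides of coassociativity live in C \ot (C \ot C) and (C \ot C) \ot C,
   which are identified by the associativity isomorphism tassoc of vector
   spaces; the same convention is used for comodules in rhoA. *)
HB.mixin Record isHomCoalgebra (k : fieldType) C of HomSpace k C := {
  comul : C -> tensor C C;
  counit : C -> k;
  comul_is_linear : linear comul;
  counit_is_scalar : scalar counit;
  comulA : forall c,
    tmap hautoV comul (comul c) = tassoc (tmap comul hautoV (comul c));
  counitr : forall c, tlift (fun c1 c2 => counit c2 *: c1) (comul c) = hautoV c;
  counitl : forall c, tlift (fun c1 c2 => counit c1 *: c2) (comul c) = hautoV c;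
  comul_hauto : forall c, comul (hauto c) = tmap hauto hauto (comul c);
  counit_hauto : forall c, counit (hauto c) = counit c
}.

#[short(type="homCoalgType")]
HB.structure Definition HomCoalgebra (k : fieldType) :=
  {C of HomSpace k C & isHomCoalgebra k C}.

Section HomCoalgebraTheory.
Variables (k : fieldType) (C : homCoalgType k).

HB.instance Definition _ :=
  GRing.isLinear.Build k C (tensor C C) _ (@comul k C) comul_is_linear.

HB.instance Definition _ :=
  GRing.isLinear.Build k C k _ (@counit k C) counit_is_scalar.

End HomCoalgebraTheory.

Section Convolution.
Variables (k : fieldType) (C : homCoalgType k) (A : homAlgType k).

Definition conv (f g : C -> A) (c : C) : A :=
  tlift (fun c1 c2 => f c1 ** g c2) (comul c).

Lemma conv_bilinear (f g : {linear C -> A}) :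
  bilinear_map (fun c1 c2 => f c1 ** g c2).
Proof.
by split=> z a x y; rewrite linearP ?(hmulDl, hmulDr) ?(hmulZl, hmulZr).
Qed.

End Convolution.

HB.mixin Record isMonoidalHomHopf (k : fieldType) H
    of HomAlgebra k H & HomCoalgebra k H := {
  antipode : H -> H;
  comulM : forall g h : H, comul (g ** h) = comul g ** comul h;
  comul1 : comul (\1 : H) = \1 \ot \1;
  counitM : forall g h : H, counit (g ** h) = counit g * counit h;
  counit1 : counit (\1 : H) = 1;
  antipode_is_linear : linear antipode;
  antipode_hauto : forall h : H, antipode (hauto h) = hauto (antipode h);
  antipodel : forall h : H, conv antipode (@id H) h = counit h *: \1;
  antipoder : forall h : H, conv (@id H) antipode h = counit h *: \1
}.

#[short(type="homHopfType")]
HB.structure Definition MonoidalHomHopf (k : fieldType) :=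
  {H of HomAlgebra k H & HomCoalgebra k H & isMonoidalHomHopf k H}.

Section HomModules.
Variables (k : fieldType) (A : homAlgType k).

Record left_hom_module (M : homSpaceType k) (act : A -> M -> M) : Prop := {
  lact_bilinear : bilinear_map act;
  lactA : forall a b m, act (hauto a) (act b m) = act (a ** b) (hauto m);
  lact1 : forall m, act \1 m = hauto m;
  lact_hauto : forall a m, hauto (act a m) = act (hauto a) (hauto m)
}.

Record right_hom_module (M : homSpaceType k) (act : M -> A -> M) : Prop := {
  ract_bilinear : bilinear_map act;
  ractA : forall m a b, act (hauto m) (a ** b) = act (act m a) (hauto b);
  ract1 : forall m, act m \1 = hauto m;
  ract_hauto : forall m a, hauto (act m a) = act (hauto m) (hauto a)
}.

Definition left_module_map (M N : homSpaceType k) (actM : A -> M -> M)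
    (actN : A -> N -> N) (f : M -> N) : Prop :=
  [/\ linear f, forall m, f (hauto m) = hauto (f m)
    & forall a m, f (actM a m) = actN a (f m)].

(* The tensor product over A as the quotient by the relations
   m a \ot n = hauto m \ot a (hautoV n). *)
Section TensorOver.
Variables (M N : homSpaceType k) (ract : M -> A -> M) (lact : A -> N -> N).

Inductive balanced_rel : tensor M N -> Prop :=
| Balanced m a n :
    balanced_rel (ract m a \ot n - hauto m \ot lact a (hautoV n)).

Definition tensor_over : Type := lquot balanced_rel.

HB.instance Definition _ := GRing.Lmodule.on tensor_over.

End TensorOver.

(* The left A-module A \ot V, with action
   a . (b \ot v) = hautoV a ** b \ot hauto v. *)
Definition free_lact (V : homSpaceType k) (a : A) : tensor A V -> tensor A V :=
  tmap (fun b => hautoV a ** b) hauto.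

Section FreeModule.
Variable V : homSpaceType k.

Lemma hmul_left_is_linear (a : A) : linear (hmul a).
Proof. by move=> x b c; rewrite hmulDr hmulZr. Qed.

HB.instance Definition _ (a : A) :=
  GRing.isLinear.Build k A A _ (hmul a) (hmul_left_is_linear a).

Lemma free_lactE a b (v : V) :
  free_lact a (b \ot v) = (hautoV a ** b) \ot hauto v.
Proof. exact: tmapE. Qed.

Lemma free_lact_is_linear a : linear (@free_lact V a).
Proof. exact: tmap_linear. Qed.

HB.instance Definition _ (a : A) := GRing.isLinear.Build k (tensor A V)
  (tensor A V) _ (@free_lact V a) (free_lact_is_linear a).

Lemma free_left_hom_module : left_hom_module (@free_lact V).
Proof.
split=> [|a b x|x|a x].
- split=> [x|a]; last exact: free_lact_is_linear.
  move=> r a b; elim/tens_ind: x => [c v|x y IHx IHy] /=.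
    by rewrite !free_lactE linearP hmulDl hmulZl tensDl tensZl.
  by move: IHx IHy => /= IHx IHy; rewrite !linearD /= IHx IHy addrACA.
- elim/tens_ind: x => [c v|x y IHx IHy]; last by rewrite !linearD /= IHx IHy.
  rewrite hauto_tens !free_lactE hautoK hautoVM; congr (_ \ot _).
  by rewrite -[in RHS]hmulA hautoVK.
- elim/tens_ind: x => [c v|x y IHx IHy]; last by rewrite !linearD /= IHx IHy.
  by rewrite free_lactE hautoV1 hmul1r hauto_tens.
- elim/tens_ind: x => [c v|x y IHx IHy]; last by rewrite !linearD /= IHx IHy.
  by rewrite free_lactE !hauto_tens free_lactE hautoM hautoK hautoVK.
Qed.

End FreeModule.
End HomModules.

Section HomComodules.
Variables (k : fieldType) (H : homCoalgType k).

Record right_hom_comodule (M : homSpaceType k) (rho : M -> tensor M H) : Prop := {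
  rho_is_linear : linear rho;
  rhoA : forall m, tmap hautoV comul (rho m) = tassoc (tmap rho hautoV (rho m));
  rho_counit : forall m, tlift (fun m0 m1 => counit m1 *: m0) (rho m) = hautoV m;
  rho_hauto : forall m, rho (hauto m) = tmap hauto hauto (rho m)
}.

Definition right_comodule_map (M N : homSpaceType k) (rhoM : M -> tensor M H)
    (rhoN : N -> tensor N H) (g : M -> N) : Prop :=
  [/\ linear g, forall m, g (hauto m) = hauto (g m)
    & forall m, rhoN (g m) = tmap g id (rhoM m)].

Lemma comul_right_hom_comodule : right_hom_comodule (@comul k H).
Proof.
split; [exact: linearP | exact: comulA | exact: counitr | exact: comul_hauto].
Qed.

Section FreeComodule.
Variable V : homSpaceType k.

(* The right H-comodule V \ot H, with coaction
   v \ot h |-> (hautoV v \ot h_1) \ot hauto h_2. *)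
Definition free_coact (x : tensor V H) : tensor (tensor V H) H :=
  tlift (fun (v : V) (h : H) =>
    tlift (fun h1 h2 => (hautoV v \ot h1) \ot hauto h2) (comul h)) x.

Lemma free_coact_bil1 (v : V) :
  bilinear_map (fun h1 h2 : H => (hautoV v \ot h1) \ot hauto h2).
Proof.
by split=> z a x y /=; rewrite ?linearP ?(tensDl, tensDr) ?(tensZl, tensZr)
  ?(tensDl, tensDr) ?(tensZl, tensZr).
Qed.

Lemma free_coact_bil2 : bilinear_map (fun (v : V) (h : H) =>
  tlift (fun h1 h2 => (hautoV v \ot h1) \ot hauto h2) (comul h)).
Proof.
split=> [h|v].
  apply: (tlift_param (f := fun v (h1 h2 : H) => (hautoV v \ot h1) \ot hauto h2))
    => [v|h1 h2 a v w]; first exact: free_coact_bil1.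
  by rewrite linearP !(tensDl, tensZl).
by move=> a h h' /=; rewrite linearP (tlift_linear (free_coact_bil1 v)).
Qed.

HB.instance Definition _ := GRing.isLinear.Build k (tensor V H)
  (tensor (tensor V H) H) _ free_coact (tlift_linear free_coact_bil2).

Lemma free_coactE v h : free_coact (v \ot h) =
  tlift (fun h1 h2 => (hautoV v \ot h1) \ot hauto h2) (comul h).
Proof. exact: tliftE free_coact_bil2 _ _. Qed.

Lemma tens_left_is_linear (v : V) : linear (@tens k V H v).
Proof. by move=> a x y; rewrite tensDr tensZr. Qed.

HB.instance Definition _ (v : V) := GRing.isLinear.Build k H (tensor V H) _
  (@tens k V H v) (tens_left_is_linear v).

Lemma free_coactA x :
  tmap hautoV comul (free_coact x) = tassoc (tmap free_coact hautoV (free_coact x)).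
Proof.
elim/tens_ind: x => [v h|x y IHx IHy]; last by rewrite !linearD /= IHx IHy.
rewrite !free_coactE; set w := hautoV (hautoV v).
transitivity (tmap (tens w) hauto (tmap hautoV comul (comul h))); last first.
  rewrite comulA; elim/tens_ind: (comul h) => [h1 h2|x y IHx IHy]; last first.
    by rewrite !(linearD, tliftD (free_coact_bil1 _)) /= IHx IHy.
  rewrite (tliftE (free_coact_bil1 _)) !tmapE /= hautoK free_coactE -/w.
  elim/tens_ind: (comul h1) => [a b|x y IHx IHy]; last first.
    rewrite tensDl !(linearD, tliftD (free_coact_bil1 _)) /= IHx.
    by rewrite tensDl linearD /= -IHy.
  rewrite (tliftE (free_coact_bil1 _)) -/w !tassocE tmapE /=.
  by rewrite hauto_tens hautoVK.
elim/tens_ind: (comul h) => [h1 h2|x y IHx IHy]; last first.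
  by rewrite !(linearD, tliftD (free_coact_bil1 _)) /= IHx IHy.
rewrite (tliftE (free_coact_bil1 _)) !tmapE /= hautoV_tens -/w.
by rewrite comul_hauto.
Qed.

Lemma free_right_hom_comodule : right_hom_comodule free_coact.
Proof.
have bc (W : homSpaceType k) :
    bilinear_map (fun (m0 : W) (m1 : H) => counit m1 *: m0).
  split=> z a x y /=; first by rewrite scalerDr !scalerA mulrC.
  by rewrite linearP /= scalerDl scalerA.
split=> [||x|x]; [exact: linearP | exact: free_coactA | |].
  elim/tens_ind: x => [v h|x y IHx IHy]; last first.
    by rewrite !(linearD, tliftD (bc _)) /= IHx IHy.
  rewrite free_coactE hautoV_tens -[X in _ = _ \ot X](counitr h).
  elim/tens_ind: (comul h) => [h1 h2|x y IHx IHy]; last first.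
    by rewrite !(tensDr, tliftD (bc _), tliftD (free_coact_bil1 _)) IHx IHy.
  by rewrite (tliftE (free_coact_bil1 _)) !(tliftE (bc _)) counit_hauto tensZr.
elim/tens_ind: x => [v h|x y IHx IHy]; last by rewrite !linearD /= IHx IHy.
rewrite hauto_tens !free_coactE comul_hauto.
elim/tens_ind: (comul h) => [h1 h2|x y IHx IHy]; last first.
  by rewrite !(linearD, tliftD (free_coact_bil1 _)) /= IHx IHy.
rewrite tmapE !(tliftE (free_coact_bil1 _)) !tmapE /= hauto_tens.
by rewrite hautoK hautoVK.
Qed.

End FreeComodule.
End HomComodules.

Definition hom_algebra_map (k : fieldType) (A B : homAlgType k) (f : A -> B) : Prop :=
  [/\ linear f, forall a, f (hauto a) = hauto (f a),
      forall a b, f (a ** b) = f a ** f b & f \1 = \1].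

HB.mixin Record isHomComoduleAlgebra (k : fieldType) (H : homHopfType k) B
    of HomAlgebra k B := {
  coact : B -> tensor B H;
  coact_right_hom_comodule : right_hom_comodule coact;
  coact_hom_algebra_map : hom_algebra_map coact
}.

#[short(type="homComodAlgType")]
HB.structure Definition HomComoduleAlgebra (k : fieldType) (H : homHopfType k) :=
  {B of HomAlgebra k B & isHomComoduleAlgebra k H B}.

Section Coinvariants.
Variables (k : fieldType) (H : homHopfType k) (B : homComodAlgType H).

Lemma coact_is_linear : linear (@coact k H B).
Proof. by case: (@coact_right_hom_comodule k H B). Qed.

HB.instance Definition _ :=
  GRing.isLinear.Build k B (tensor B H) _ (@coact k H B) coact_is_linear.

Lemma coact_hauto (b : B) : coact (hauto b) = hauto (coact b).
Proof. by case: (@coact_hom_algebra_map k H B). Qed.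
Lemma coactM (a b : B) : coact (a ** b) = coact a ** coact b.
Proof. by case: (@coact_hom_algebra_map k H B). Qed.
Lemma coact1 : coact (\1 : B) = \1.
Proof. by case: (@coact_hom_algebra_map k H B). Qed.

Definition coinvariant : {pred B} :=
  fun b => `[< coact b = hautoV b \ot \1 >].

Lemma coinvariantP b : reflect (coact b = hautoV b \ot \1) (b \in coinvariant).
Proof. exact: asboolP. Qed.

Lemma coinvariant_submod : submod_closed coinvariant.
Proof.
split=> [|a x y /coinvariantP cx /coinvariantP cy]; apply/coinvariantP.
  by rewrite !linear0 tens0l.
by rewrite !linearP /= cx cy tensDl tensZl.
Qed.

HB.instance Definition _ :=
  GRing.isSubmodClosed.Build k B coinvariant coinvariant_submod.

Record coinv := Coinv { coinv_val :> B; _ : coinv_val \in coinvariant }.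

HB.instance Definition _ := [isSub for coinv_val].
HB.instance Definition _ := [Choice of coinv by <:].
HB.instance Definition _ := [SubChoice_isSubLmodule of coinv by <:].

Lemma coinvE (a : coinv) : coact (val a) = hautoV (val a) \ot \1.
Proof. exact/coinvariantP/valP. Qed.

Lemma coinvariant_hauto b : b \in coinvariant -> hauto b \in coinvariant.
Proof.
move=> /coinvariantP cb; apply/coinvariantP.
by rewrite coact_hauto cb hauto_tens hauto1 hautoK hautoVK.
Qed.

Lemma coinvariant_hautoV b : b \in coinvariant -> hautoV b \in coinvariant.
Proof.
move=> /coinvariantP cb; apply/coinvariantP.
apply: (can_inj hautoK).
by rewrite -coact_hauto hautoVK cb hauto_tens hauto1 hautoVK.
Qed.

Lemma coinvariantM a b :
  a \in coinvariant -> b \in coinvariant -> a ** b \in coinvariant.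
Proof.
move=> /coinvariantP ca /coinvariantP cb; apply/coinvariantP.
by rewrite coactM ca cb hmul_tens hmulr1 hauto1 hautoVM.
Qed.

Lemma coinvariant1 : \1 \in coinvariant.
Proof. by apply/coinvariantP; rewrite coact1 hautoV1. Qed.

Definition coinv_auto (a : coinv) := Coinv (coinvariant_hauto (valP a)).
Definition coinv_autoV (a : coinv) := Coinv (coinvariant_hautoV (valP a)).
Definition coinv_mul (a b : coinv) := Coinv (coinvariantM (valP a) (valP b)).
Definition coinv_one := Coinv coinvariant1.

Lemma coinv_auto_is_linear : linear coinv_auto.
Proof. by move=> r a b; apply/val_inj; rewrite /= !linearP. Qed.

Lemma coinv_autoK : cancel coinv_auto coinv_autoV.
Proof. by move=> a; apply/val_inj; rewrite /= hautoK. Qed.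

Lemma coinv_autoVK : cancel coinv_autoV coinv_auto.
Proof. by move=> a; apply/val_inj; rewrite /= hautoVK. Qed.

HB.instance Definition _ := hasHomAutomorphism.Build k coinv
  coinv_auto_is_linear coinv_autoK coinv_autoVK.

Lemma coinv_mul_bilinear : bilinear_map coinv_mul.
Proof.
by split=> z a x y; apply/val_inj;
  rewrite /= ?linearP /= ?(hmulDl, hmulDr) ?(hmulZl, hmulZr).
Qed.

Lemma coinv_mulA a b c :
  coinv_mul (hauto a) (coinv_mul b c) = coinv_mul (coinv_mul a b) (hauto c).
Proof. by apply/val_inj; apply: hmulA. Qed.

Lemma coinv_mulr1 a : coinv_mul a coinv_one = hauto a.
Proof. by apply/val_inj; apply: hmulr1. Qed.

Lemma coinv_mul1r a : coinv_mul coinv_one a = hauto a.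
Proof. by apply/val_inj; apply: hmul1r. Qed.

Lemma coinv_autoM a b : hauto (coinv_mul a b) = coinv_mul (hauto a) (hauto b).
Proof. by apply/val_inj; apply: hautoM. Qed.

Lemma coinv_auto1 : hauto coinv_one = coinv_one.
Proof. by apply/val_inj; apply: hauto1. Qed.

HB.instance Definition _ := isHomAlgebra.Build k coinv
  coinv_mul_bilinear coinv_mulA coinv_mulr1 coinv_mul1r coinv_autoM coinv_auto1.

Definition coinv_lact (a : coinv) (b : B) : B := val a ** b.
Definition coinv_ract (b : B) (a : coinv) : B := b ** val a.

Lemma coinv_left_hom_module : left_hom_module coinv_lact.
Proof.
split=> [|a b c|b|a b]; rewrite /coinv_lact.
- by split=> z a x y; rewrite /= ?linearP /= ?(hmulDl, hmulDr) ?(hmulZl, hmulZr).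
- exact: hmulA.
- exact: hmul1r.
- exact: hautoM.
Qed.

Lemma coinv_right_hom_module : right_hom_module coinv_ract.
Proof.
split=> [|a b c|b|a b]; rewrite /coinv_ract.
- by split=> z a x y; rewrite /= ?linearP /= ?(hmulDl, hmulDr) ?(hmulZl, hmulZr).
- exact: hmulA.
- exact: hmulr1.
- exact: hautoM.
Qed.

Definition cleft : Prop :=
  exists g : {linear H -> B}, exists g' : {linear H -> B},
    [/\ right_comodule_map comul coact g,
        forall h, conv g g' h = counit h *: \1
      & forall h, conv g' g h = counit h *: \1].

(* x \ot y |-> (hautoV x ** y_(0)) \ot hauto y_(1), on the tensor product over k;
   galois_map is the map it induces on the tensor product over coinv. *)
Definition pre_galois_map : tensor B B -> tensor B H :=
  tlift (fun x y =>
    tlift (fun y0 y1 => (hautoV x ** y0) \ot hauto y1) (coact y)).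

Lemma pre_galois_bil1 (x : B) :
  bilinear_map (fun (y0 : B) (y1 : H) => (hautoV x ** y0) \ot hauto y1).
Proof.
by split=> z a u v /=; rewrite ?linearP ?hmulDr ?hmulZr
  ?(tensDl, tensDr) ?(tensZl, tensZr).
Qed.

Lemma pre_galois_bil2 : bilinear_map (fun x y : B =>
  tlift (fun (y0 : B) (y1 : H) => (hautoV x ** y0) \ot hauto y1) (coact y)).
Proof.
split=> [y|x].
  apply: (tlift_param (f := fun x y0 (y1 : H) => (hautoV x ** y0) \ot hauto y1))
    => [x|y0 y1 a u v]; first exact: pre_galois_bil1.
  by rewrite linearP hmulDl hmulZl tensDl tensZl.
by move=> a u v /=; rewrite linearP (tlift_linear (pre_galois_bil1 x)).
Qed.

HB.instance Definition _ := GRing.isLinear.Build k _ _ _ pre_galois_map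
  (tlift_linear pre_galois_bil2).

Lemma pre_galois_mapE x y : pre_galois_map (x \ot y) =
  tlift (fun y0 y1 => (hautoV x ** y0) \ot hauto y1) (coact y).
Proof. exact: tliftE pre_galois_bil2 _ _. Qed.

Lemma pre_galois_map_balanced u :
  balanced_rel coinv_ract coinv_lact u -> pre_galois_map u = 0.
Proof.
case=> m a n; rewrite linearB /= !pre_galois_mapE.
apply/eqP; rewrite subr_eq0; apply/eqP.
rewrite /coinv_ract /coinv_lact coactM coinvE hautoK.
have -> : coact n = hauto (coact (hautoV n)) by rewrite -coact_hauto hautoVK.
elim/tens_ind: (coact (hautoV n)) => [n0 n1|x y IHx IHy].
  rewrite hauto_tens hmul_tens (tliftE (pre_galois_bil1 _)).
  rewrite (tliftE (f := fun y0 y1 => (m ** y0) \ot hauto y1)) /=; last first.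
    by have := pre_galois_bil1 (hauto m); rewrite hautoK.
  by rewrite hautoVM -hmulA hautoVK hmul1r.
have bm : bilinear_map (fun (y0 : B) (y1 : H) => (m ** y0) \ot hauto y1).
  by have := pre_galois_bil1 (hauto m); rewrite hautoK.
rewrite linearD hmulDr !(tliftD (pre_galois_bil1 _)) (tliftD bm).
by rewrite /= IHx IHy.
Qed.

Definition tensor_coinv : Type := tensor_over coinv_ract coinv_lact.

HB.instance Definition _ := GRing.Lmodule.on tensor_coinv.

Definition galois_map : tensor_coinv -> tensor B H := qlift pre_galois_map.

Lemma galois_map_is_linear : linear galois_map.
Proof. exact/qlift_linear/pre_galois_map_balanced. Qed.

HB.instance Definition _ := GRing.isLinear.Build k tensor_coinv (tensor B H) _
  galois_map galois_map_is_linear.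

Lemma galois_mapE (x y : B) :
  galois_map (qproj (balanced_rel coinv_ract coinv_lact) (x \ot y)) =
  tlift (fun y0 y1 => (hautoV x ** y0) \ot hauto y1) (coact y).
Proof.
rewrite -pre_galois_mapE; exact: qliftE pre_galois_map_balanced _.
Qed.

Definition galois : Prop := bijective galois_map.

Definition normal_base : Prop :=
  exists f : {linear B -> tensor coinv H},
    [/\ bijective f, left_module_map coinv_lact (@free_lact k coinv H) f
      & right_comodule_map coact (@free_coact k H coinv) f].

End Coinvariants.

Arguments cleft {k H} B.
Arguments galois {k H} B.
Arguments normal_base {k H} B.

(* Main.v *)
Require Import Defs.
From HB Require Import structures.
From mathcomp Require Import all_boot all_algebra.
From mathcomp Require Import boolp.

Set Implicit Arguments.
Unset Strict Implicit.
Unset Printing Implicit Defensive.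

Import GRing.Theory.
Local Open Scope ring_scope.

(** Why the theorem holds. Every Hom-structure here is an ordinary structure
    twisted by an automorphism. In a Hom-algebra with automorphism beta, the
    product a . b = beta^-1 (a b) is associative and unital ([umulA], [umul1r],
    [umulr1]); precomposing a coaction rho with the automorphism gives an
    ordinary coaction. For these untwisted operations the convolution
    (u * v)(m) = u(m_0) . v(m_1) is associative ([uconvA]) with unit
    h |-> epsilon(h) 1 ([ueps]); convolution inverses, coinvariants and the
    canonical Galois map are the same as for the twisted operations ([cleftP],
    [ucoact_coinv], [galois_map_qproj]). The normal base property says that
    some colinear g : H -> B makes a \ot h |-> a . g(h) a bijection from
    A \ot H to B ([normal_baseP]). The ordinary theorem of Doi and Takeuchi then
    becomes a computation with convolutions. Write i(b) = b \ot 1 and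
    j(h) = 1 \ot h, so that rho = i * j, and rho g = i g * j when g is colinear.

    Let g be cleaving, with convolution inverse g'. Then P = id * g' takes its
    values in A: from P * g = id one gets rho = i P * i g * j = i P * rho g, hence
    rho P = rho * rho g' = i P * rho (g * g') = i P ([coinv_partP]). The inverse
    of a \ot h |-> a . g(h) is b |-> P(b_0) \ot b_1 ([base_map_bij]), and the
    inverse of the Galois map is x \ot h |-> x g'(h_1) \ot_A g(h_2)
    ([galois_of_cleft]).

    Conversely, let the Galois map and a \ot h |-> a . g(h) be bijective. Since
    x \ot b |-> x . (id * v)(b) is the composite of the Galois map with
    x \ot h |-> x . v(h), bijectivity of the former makes v |-> id * v a bijection
    from the linear maps H -> B to the left A-linear maps B -> B
    ([uconv_id_inj], [uconv_id_surj]). Define theta by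
    theta(a . g(h)) = epsilon(h) a; then theta g = epsilon 1 and theta * g = id.
    The map g' with id * g' = theta satisfies g * g' = (id * g') g = theta g =
    epsilon 1, and id * (g' * g) = theta * g = id = id * epsilon 1 gives
    g' * g = epsilon 1 ([cleft_of_galois]). *)

(** * The untwisted product *)

Section Untwisting.
Variables (k : fieldType) (R : homAlgType k).
Implicit Types a b c : R.

Definition umul a b : R := hautoV (a ** b).

Lemma umul_bilinear : bilinear_map umul.
Proof.
by split=> z a x y; rewrite /umul ?(hmulDl, hmulDr) ?(hmulZl, hmulZr) linearP.
Qed.

Lemma umulDl a b c : umul (a + b) c = umul a c + umul b c.
Proof. by rewrite /umul hmulDl linearD. Qed.
Lemma umulDr a b c : umul a (b + c) = umul a b + umul a c.
Proof. by rewrite /umul hmulDr linearD. Qed.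
Lemma umulZl x a b : umul (x *: a) b = x *: umul a b.
Proof. by rewrite /umul hmulZl linearZ. Qed.
Lemma umulZr x a b : umul a (x *: b) = x *: umul a b.
Proof. by rewrite /umul hmulZr linearZ. Qed.

(** Writing every factor as an image of beta^-1 turns this into Hom-associativity:
    the surplus automorphism on the outer factors is absorbed by the twist. *)
Lemma umulA a b c : umul a (umul b c) = umul (umul a b) c.
Proof.
by rewrite /umul !hautoVM -[hautoV a in LHS]hautoVK hmulA hautoVK.
Qed.

Lemma umul1r a : umul \1 a = a.
Proof. by rewrite /umul hmul1r hautoK. Qed.

Lemma umulr1 a : umul a \1 = a.
Proof. by rewrite /umul hmulr1 hautoK. Qed.

Definition umul_tensor : tensor R R -> R := tlift umul.

HB.instance Definition _ := GRing.isLinear.Build k (tensor R R) R _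
  umul_tensor (tlift_linear umul_bilinear).

Lemma umul_tensorE a b : umul_tensor (a \ot b) = umul a b.
Proof. exact: tliftE umul_bilinear _ _. Qed.

End Untwisting.

Section TensorFactors.
Variables (k : fieldType) (A B : homAlgType k).

Lemma umul_tens (a c : A) (b d : B) :
  umul (a \ot b) (c \ot d) = umul a c \ot umul b d.
Proof. by rewrite /umul hmul_tens hautoV_tens. Qed.

Definition tinl (a : A) : tensor A B := a \ot \1.
Definition tinr (b : B) : tensor A B := \1 \ot b.

Lemma tinl_is_linear : linear tinl.
Proof. by move=> x a b; rewrite /tinl tensDl tensZl. Qed.
Lemma tinr_is_linear : linear tinr.
Proof. by move=> x a b; rewrite /tinr tensDr tensZr. Qed.

HB.instance Definition _ := GRing.isLinear.Build k A (tensor A B) _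
  tinl tinl_is_linear.
HB.instance Definition _ := GRing.isLinear.Build k B (tensor A B) _
  tinr tinr_is_linear.

Lemma tinlM a b : tinl (umul a b) = umul (tinl a) (tinl b).
Proof. by rewrite umul_tens umulr1. Qed.

Lemma tinl_tinr a b : umul (tinl a) (tinr b) = a \ot b.
Proof. by rewrite umul_tens umulr1 umul1r. Qed.

Lemma tinl_tens a b c : umul (tinl a) (b \ot c) = umul a b \ot c.
Proof. by rewrite umul_tens umul1r. Qed.

End TensorFactors.

Arguments tinl {k A B} a.
Arguments tinr {k A B} b.

(** * Pairings and convolution *)

Section Pairing.
Variables (k : fieldType) (M N : lmodType k) (R : homAlgType k).

(** The Galois map and the normal base map are of the form m \ot n |-> u(m) . v(n),
    and a convolution is such a map composed with a coaction. *)
Definition tpair (u : M -> R) (v : N -> R) : tensor M N -> R :=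
  fun z => umul_tensor (tmap u v z).

Arguments tpair : simpl never.

Lemma tpair_is_linear (u : {linear M -> R}) (v : {linear N -> R}) :
  linear (tpair u v).
Proof. by move=> a x y; rewrite /tpair !linearP. Qed.

HB.instance Definition _ (u : {linear M -> R}) (v : {linear N -> R}) :=
  GRing.isLinear.Build k (tensor M N) R _ (tpair u v) (tpair_is_linear u v).

Lemma tpairE (u : {linear M -> R}) (v : {linear N -> R}) m n :
  tpair u v (m \ot n) = umul (u m) (v n).
Proof. by rewrite /tpair tmapE umul_tensorE. Qed.

End Pairing.

Lemma tpair_morph (k : fieldType) (M N : lmodType k) (R R' : homAlgType k)
    (f : {linear R -> R'}) (u : {linear M -> R}) (v : {linear N -> R}) z :
  {morph f : a b / umul a b} -> f (tpair u v z) = tpair (f \o u) (f \o v) z.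
Proof.
move=> fM; elim/tens_ind: z => [m n|x y IHx IHy]; last first.
  by rewrite !linearD /=; move: IHx IHy => /= -> ->.
by rewrite !tpairE fM.
Qed.

(** Used in two ways: with u multiplicative and c = u(a), and with u : B -> R
    linear over the coinvariants, a coinvariant and c its image in R. *)
Lemma tpair_lmul (k : fieldType) (A N R : homAlgType k)
    (u : {linear A -> R}) (v : {linear N -> R}) (a : A) (c : R) z :
    (forall b, u (umul a b) = umul c (u b)) ->
  tpair u v (umul (tinl a) z) = umul c (tpair u v z).
Proof.
move=> ua; elim/tens_ind: z => [b n|x y IHx IHy].
  by rewrite tinl_tens !tpairE ua umulA.
by rewrite umulDr !linearD /= umulDr IHx IHy.
Qed.

Lemma tmapD (k : fieldType) (M N M' N' : lmodType k)
    (f : {linear M -> M'}) (g : {linear N -> N'}) x y :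
  tmap f g (x + y) = tmap f g x + tmap f g y.
Proof. exact: linearD. Qed.

Lemma tpair_tmap (k : fieldType) (M N M' N' : lmodType k) (R : homAlgType k)
    (f : {linear M -> M'}) (g : {linear N -> N'})
    (u : {linear M' -> R}) (v : {linear N' -> R}) z :
  tpair u v (tmap f g z) = tpair (u \o f) (v \o g) z.
Proof.
elim/tens_ind: z => [m n|x y IHx IHy]; last by rewrite !linearD /= IHx IHy.
by rewrite tmapE !tpairE.
Qed.

Lemma tpair_tinl_tinr (k : fieldType) (A B : homAlgType k) (z : tensor A B) :
  tpair tinl tinr z = z.
Proof.
elim/tens_ind: z => [a b|x y IHx IHy]; last by rewrite !linearD /= IHx IHy.
by rewrite tpairE /= tinl_tinr.
Qed.

Section Uconv.
Variables (k : fieldType) (H : homCoalgType k) (M : homSpaceType k).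
Variables (rho : {linear M -> tensor M H}) (R : homAlgType k).

Definition uconv (u : M -> R) (v : H -> R) : M -> R :=
  fun m => tpair u v (rho (hauto m)).

Arguments uconv : simpl never.

Lemma uconvE (u : M -> R) (v : H -> R) m :
  uconv u v m = tpair u v (rho (hauto m)).
Proof. by []. Qed.

Lemma uconv_is_linear (u : {linear M -> R}) (v : {linear H -> R}) :
  linear (uconv u v).
Proof. by move=> a x y; rewrite /uconv !linearP. Qed.

HB.instance Definition _ (u : {linear M -> R}) (v : {linear H -> R}) :=
  GRing.isLinear.Build k M R _ (uconv u v) (uconv_is_linear u v).

Definition ueps (h : H) : R := counit h *: \1.

Lemma ueps_is_linear : linear ueps.
Proof. by move=> a x y; rewrite /ueps linearP scalerDl scalerA. Qed.

HB.instance Definition _ := GRing.isLinear.Build k H R _ ueps ueps_is_linear.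

Hypothesis rhoP : right_hom_comodule rho.

Lemma uconv_eps (u : {linear M -> R}) : uconv u ueps = u.
Proof.
apply/funext => m; rewrite /uconv.
have cb : bilinear_map (fun (m0 : M) (m1 : H) => counit m1 *: m0).
  split=> z a x y /=; first by rewrite scalerDr !scalerA mulrC.
  by rewrite linearP /= scalerDl scalerA.
rewrite -[in RHS](hautoK m) -(rho_counit rhoP).
elim/tens_ind: (rho _) => [n h|x y IHx IHy].
  by rewrite tpairE tliftE // umulZr umulr1 linearZ.
by rewrite (tliftD cb) !linearD /=; move: IHx IHy => /= -> ->.
Qed.

End Uconv.

Arguments ueps {k H R} h.

Lemma uconv_morph (k : fieldType) (H : homCoalgType k)
    (R R' : homAlgType k) (M : homSpaceType k)
    (rho : {linear M -> tensor M H}) (f : {linear R -> R'})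
    (u : {linear M -> R}) (v : {linear H -> R}) :
  {morph f : a b / umul a b} -> f \o uconv rho u v = uconv rho (f \o u) (f \o v).
Proof.
by move=> fM; apply/funext => m; rewrite /= uconvE (tpair_morph _ _ _ fM).
Qed.

Lemma ueps_morph (k : fieldType) (H : homCoalgType k)
    (R R' : homAlgType k) (f : {linear R -> R'}) :
  f \1 = \1 -> f \o ueps (H := H) = ueps.
Proof. by move=> f1; apply/funext => h; rewrite /= /ueps linearZ_LR f1. Qed.

(** Evaluating Hom-coassociativity at beta^2 m removes every inverse automorphism
    from it and leaves ordinary coassociativity of the untwisted coaction. *)
Lemma uconvA (k : fieldType) (H : homCoalgType k) (M : homSpaceType k)
    (rho : {linear M -> tensor M H}) (R : homAlgType k)
    (u : {linear M -> R}) (v w : {linear H -> R}) :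
    right_hom_comodule rho ->
  uconv rho (uconv rho u v) w = uconv rho u (uconv comul v w).
Proof.
move=> rhoP; apply/funext => m; rewrite !(uconvE _ _ _ m).
have /(congr1 (tpair u (tpair v w))) := rhoA rhoP (hauto (hauto m)).
rewrite (rho_hauto rhoP (hauto m)) => coassoc.
transitivity (tpair u (tpair v w)
    (tassoc (tmap rho hautoV (tmap hauto hauto (rho (hauto m)))))); last first.
  rewrite -coassoc; elim/tens_ind: (rho (hauto m)) => [n h|x y IHx IHy].
    by rewrite !tmapE /= hautoK !tpairE.
  by rewrite !linearD; exact: (congr2 +%R IHx IHy).
elim/tens_ind: (rho (hauto m)) {coassoc} => [n h|x y IHx IHy]; last first.
  by rewrite !linearD; exact: (congr2 +%R IHx IHy).
rewrite !tmapE /= hautoK tpairE /= uconvE.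
elim/tens_ind: (rho (hauto n)) => [n' h'|x y IHx IHy].
  by rewrite tassocE !tpairE /= tpairE umulA.
by rewrite tensDl !linearD /= umulDl; exact: (congr2 +%R IHx IHy).
Qed.

Lemma ueps_conv (k : fieldType) (H : homCoalgType k) (R : homAlgType k)
    (v : {linear H -> R}) : uconv comul ueps v = v.
Proof.
apply/funext => h; rewrite /uconv.
have cb : bilinear_map (fun (h1 h2 : H) => counit h1 *: h2).
  split=> z a x y /=; last by rewrite scalerDr !scalerA mulrC.
  by rewrite linearP /= scalerDl scalerA.
have -> z : tpair ueps v z = v (tlift (fun h1 h2 : H => counit h1 *: h2) z).
  elim/tens_ind: z => [g h'|x y IHx IHy].
    by rewrite tpairE tliftE // umulZl umul1r linearZ.
  by rewrite (tliftD cb) !linearD /= IHx IHy.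
by rewrite -[in RHS](hautoK h); apply: congr1; apply: counitl.
Qed.

(** The two convolutions differ by the automorphisms of source and target only,
    and the convolution unit is invariant under both. *)
Lemma conv_uconv (k : fieldType) (H : homCoalgType k) (R : homAlgType k)
    (u v : {linear H -> R}) h : conv u v (hauto h) = hauto (uconv comul u v h).
Proof.
rewrite uconvE.
have -> z : hauto (tpair u v z) = tlift (fun c1 c2 => u c1 ** v c2) z.
  elim/tens_ind: z => [n g|x y IHx IHy].
    by rewrite (tliftE (conv_bilinear u v)) tpairE /umul hautoVK.
  by rewrite (tliftD (conv_bilinear u v)) !linearD /= IHx IHy.
by [].
Qed.

Lemma conv_epsP (k : fieldType) (H : homCoalgType k) (R : homAlgType k)
    (u v : {linear H -> R}) :
  (forall h, conv u v h = counit h *: \1) <-> uconv comul u v = ueps.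
Proof.
split=> [uv|uv h].
  apply/funext => h; apply: (can_inj hautoK).
  by rewrite -conv_uconv uv linearZ_LR /= hauto1 counit_hauto.
by rewrite -[h]hautoVK conv_uconv uv linearZ_LR /= hauto1 counit_hauto.
Qed.

(** * The untwisted coaction *)

Local Notation coinv_proj B :=
  (qproj (balanced_rel (@coinv_ract _ _ B) (@coinv_lact _ _ B))).

Section UntwistedCoaction.
Variables (k : fieldType) (H : homHopfType k) (B : homComodAlgType H).
Implicit Types (a b x y : B) (h : H).

Definition ucoact b : tensor B H := coact (hauto b).

Arguments ucoact : simpl never.

Lemma ucoact_is_linear : linear ucoact.
Proof. by move=> a x y; rewrite /ucoact !linearP. Qed.

HB.instance Definition _ := GRing.isLinear.Build k B (tensor B H) _
  ucoact ucoact_is_linear.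

Lemma ucoactM a b : ucoact (umul a b) = umul (ucoact a) (ucoact b).
Proof.
by rewrite /ucoact /umul hautoVK coactM !coact_hauto -hautoM hautoK.
Qed.

Lemma ucoact1 : ucoact \1 = \1.
Proof. by rewrite /ucoact hauto1 coact1. Qed.

Lemma coinvariant_ucoact b : ucoact b = tinl b -> b \in coinvariant (B := B).
Proof.
move=> cb; apply/coinvariantP; apply: (can_inj hautoK).
by rewrite -coact_hauto -/(ucoact b) cb hauto_tens hautoVK hauto1.
Qed.

Lemma ucoact_coinv (a : coinv B) : ucoact (val a) = tinl (val a).
Proof. by rewrite /ucoact coact_hauto coinvE hauto_tens hautoVK hauto1. Qed.

Lemma uconv_coactE (R : homAlgType k) (u : B -> R) (v : H -> R) b :
  uconv coact u v b = tpair u v (ucoact b).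
Proof. by []. Qed.

Lemma uconv_lmul (R : homAlgType k) (u : {linear B -> R}) (v : {linear H -> R})
    (a : coinv B) (c : R) b :
    (forall x, u (umul (val a) x) = umul c (u x)) ->
  uconv coact u v (umul (val a) b) = umul c (uconv coact u v b).
Proof.
by move=> ua; rewrite !uconv_coactE ucoactM ucoact_coinv (tpair_lmul _ _ ua).
Qed.

Definition ucolinear (g : {linear H -> B}) : Prop :=
  (forall h, g (hauto h) = hauto (g h)) /\
  (forall h, ucoact (g h) = tmap g id (comul (hauto h))).

Lemma ucolinearP (g : {linear H -> B}) :
  right_comodule_map comul coact g <-> ucolinear g.
Proof.
split=> [[_ gh gc]|[gh gc]].
  by split=> // h; rewrite /ucoact -gh gc.
split=> // [|h]; first exact: linearP.
by rewrite -[h]hautoVK -gc /ucoact -gh.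
Qed.

(** Precomposing with a colinear map turns convolution over B into convolution
    over H. *)
Lemma uconv_comp (g : {linear H -> B}) (R : homAlgType k) (u : {linear B -> R})
    (v : {linear H -> R}) : ucolinear g ->
  uconv coact u v \o g = uconv comul (u \o g) v.
Proof.
case=> _ gc; apply/funext => h; rewrite /= uconv_coactE uconvE gc.
exact: (tpair_tmap g idfun u v).
Qed.

Lemma ucoact_uconv : ucoact = uconv coact tinl tinr.
Proof.
by apply/funext => b; rewrite uconv_coactE tpair_tinl_tinr.
Qed.

Lemma ucoact_comp (g : {linear H -> B}) : ucolinear g ->
  ucoact \o g = uconv comul (tinl \o g) tinr.
Proof. by move=> gc; rewrite ucoact_uconv uconv_comp. Qed.

(** Thus the Galois map is x \ot y |-> (x \ot 1) . rho(y), with rho untwisted. *)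
Lemma pre_galois_tpair : pre_galois_map (B := B) =1 tpair tinl ucoact.
Proof.
elim/tens_ind => [x y|x y IHx IHy]; last by rewrite !linearD /= IHx IHy.
rewrite pre_galois_mapE tpairE /= /ucoact coact_hauto.
have -> z : tlift (fun (y0 : B) (y1 : H) => (hautoV x ** y0) \ot hauto y1) z =
  umul (tinl x) (hauto z).
  elim/tens_ind: z => [y0 y1|z t IHz IHt]; last first.
    by rewrite (tliftD (pre_galois_bil1 _)) linearD /= umulDr IHz IHt.
  rewrite (tliftE (pre_galois_bil1 _)) hauto_tens tinl_tens.
  by rewrite /umul hautoVM hautoK.
by [].
Qed.

Lemma galois_map_qproj w :
  galois_map (coinv_proj B w) = tpair tinl ucoact w.
Proof.
by rewrite -pre_galois_tpair; apply: qliftE; apply: pre_galois_map_balanced.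
Qed.

End UntwistedCoaction.

(** * Normal bases *)

Section NormalBase.
Variables (k : fieldType) (H : homHopfType k) (B : homComodAlgType H).
Implicit Types (a : coinv B) (b : B) (h : H) (g : {linear H -> B}).

Definition base_map (g : H -> B) : tensor (coinv B) H -> B := tpair val g.

Arguments base_map : simpl never.

HB.instance Definition _ g :=
  GRing.isLinear.Build k (tensor (coinv B) H) B _ (base_map g)
    (tpair_is_linear (val : coinv B -> B) g).

Lemma base_mapE g a h : base_map g (a \ot h) = umul (val a) (g h).
Proof. exact: tpairE. Qed.

Lemma base_map_hauto g x : (forall h, g (hauto h) = hauto (g h)) ->
  base_map g (hauto x) = hauto (base_map g x).
Proof.
move=> gh; elim/tens_ind: x => [a h|x y IHx IHy]; last first.
  by rewrite !linearD /= IHx IHy.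
by rewrite hauto_tens !base_mapE gh /umul hautoVK /= -hautoM hautoK.
Qed.

Lemma base_map_free_lact g a x : (forall h, g (hauto h) = hauto (g h)) ->
  base_map g (hauto (free_lact a x)) = coinv_lact a (base_map g (hauto x)).
Proof.
move=> gh; rewrite /coinv_lact; elim/tens_ind: x => [c h|x y IHx IHy]; last first.
  by rewrite !linearD /= IHx IHy.
rewrite free_lactE !hauto_tens !base_mapE !gh /umul.
by rewrite -!hautoM !hautoK /= -[in LHS]hmulA hautoVK.
Qed.

(** Colinearity of the inverse f of base_map g \o hauto. It is checked on
    images, where it reduces to the colinearity of g. *)
Lemma coact_base_map g (f : {linear B -> tensor (coinv B) H}) x :
    ucolinear g -> cancel (base_map g \o hauto) f ->
  tmap f id (coact (base_map g (hauto x))) = free_coact x.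
Proof.
move=> [gh gc] fK; elim/tens_ind: x => [a h|x y IHx IHy]; last first.
  by rewrite !linearD /= (tmapD f idfun); exact: (congr2 +%R IHx IHy).
rewrite hauto_tens base_mapE free_coactE gh /umul -hautoM hautoK coactM coinvE.
have -> : coact (g h) = tmap g id (comul h).
  by rewrite -[h]hautoVK gh -/(ucoact _) gc.
have E z : tmap f id ((hautoV (val a) \ot \1) ** tmap g id z) =
      tlift (fun h1 h2 => (hautoV a \ot h1) \ot hauto h2) z.
  elim/tens_ind: z => [h1 h2|x y IHx IHy]; last first.
    rewrite (tmapD g idfun) hmulDr (tmapD f idfun) (tliftD (free_coact_bil1 H a)).
    exact: (congr2 +%R IHx IHy).
  rewrite (tliftE (free_coact_bil1 H a)) (tmapE g idfun) hmul_tens hmul1r.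
  rewrite (tmapE f idfun) /=.
  congr (_ \ot _); rewrite -[RHS]fK /= hauto_tens base_mapE gh.
  by rewrite /umul -hautoM hautoK.
exact: E.
Qed.

(** Untwisting A \ot H gives the structure transported from
    a . (b \ot h) = a . b \ot h and id \ot Delta along the inverse of its
    automorphism. This is why g(h) is the preimage of 1 \ot alpha^-1 h, and why the
    isomorphism obtained from g is the inverse of base_map g followed by the
    inverse automorphism. *)
Lemma normal_baseP :
  normal_base B <-> exists g, ucolinear g /\ bijective (base_map g).
Proof.
split=> [[f [[e fK eK] [_ fh fa] [_ _ fc]]]|[g [gc [e gK eK]]]].
  have elin : linear e by exact: can2_linear fK eK.
  pose eL : {linear _ -> _} := HB.pack e (GRing.isLinear.Build k _ _ _ e elin).
  pose g : {linear H -> B} := eL \o tinr \o hautoV.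
  have gE h : g h = e (\1 \ot hautoV h) by [].
  have fbase x : f (base_map g x) = hautoV x.
    elim/tens_ind: x => [a h|x y IHx IHy]; last by rewrite !linearD /= IHx IHy.
    rewrite base_mapE gE; apply: (can_inj hautoK).
    rewrite -fh /umul [in LHS]hautoVK [LHS](fa a _) eK !hautoVK free_lactE.
    by rewrite hmulr1 !hautoVK.
  exists g; split; last first.
    by exists (hauto \o f) => [x|b] /=; rewrite ?fbase ?hautoVK //;
      apply: (can_inj fK); rewrite fbase hautoK.
  have gh h : g (hauto h) = hauto (g h).
    by apply: (can_inj fK); rewrite fh !gE !eK hauto_tens hauto1 hautoK hautoVK.
  split=> // h; rewrite /ucoact -gh; set h' := hauto h.
  have tf_inj : injective (tmap f (@id H)).
    apply: (can_inj (g := tmap eL id)); elim/tens_ind => [b c|x y IHx IHy].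
      by rewrite (tmapE f idfun) (tmapE eL idfun) /= fK.
    by rewrite (tmapD f idfun) (tmapD eL idfun); exact: (congr2 +%R IHx IHy).
  apply: tf_inj; apply: etrans (esym (fc _)) _.
  rewrite [X in free_coact X](_ : _ = \1 \ot hautoV h'); last by rewrite gE eK.
  rewrite free_coactE hautoV1.
  have -> : comul h' = tmap hauto hauto (comul (hautoV h')).
    by rewrite -comul_hauto hautoVK.
  have E z : tmap f id (tmap g id (tmap hauto hauto z)) =
      tlift (fun h1 h2 => (\1 \ot h1) \ot hauto h2) z.
    have bl := free_coact_bil1 H (\1 : coinv B); rewrite hautoV1 in bl.
    elim/tens_ind: z => [h1 h2|x y IHx IHy].
      rewrite (tliftE bl) tmapE (tmapE g idfun) (tmapE f idfun).
      by congr (_ \ot _); rewrite gE eK hautoK.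
    rewrite (tmapD hauto hauto) (tmapD g idfun) (tmapD f idfun) (tliftD bl).
    exact: (congr2 +%R IHx IHy).
  exact/esym/E.
have elin : linear e by exact: can2_linear gK eK.
pose eL : {linear _ -> _} := HB.pack e (GRing.isLinear.Build k _ _ _ e elin).
pose f : {linear B -> tensor (coinv B) H} := hautoV \o eL.
have fK : cancel (base_map g \o hauto) f by move=> x; rewrite /= gK hautoK.
have Kf : cancel f (base_map g \o hauto) by move=> b; rewrite /= hautoVK eK.
have [gh _] := gc.
exists f; split; first by exists (base_map g \o hauto).
  split=> [|b|a b]; first exact: linearP.
    by rewrite -[b in LHS]Kf /= -base_map_hauto // gK hautoK hautoVK.
  by rewrite -[b in LHS]Kf /= -base_map_free_lact // gK hautoK.
split=> [|b|b]; first exact: linearP.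
  by rewrite -[b in LHS]Kf /= -base_map_hauto // gK hautoK hautoVK.
by rewrite -[b in RHS]Kf [RHS](coact_base_map _ gc fK).
Qed.

End NormalBase.

(** * Cleft extensions are Galois with a normal base *)

Lemma cleftP (k : fieldType) (H : homHopfType k) (B : homComodAlgType H) :
  cleft B <-> exists g g' : {linear H -> B},
    [/\ ucolinear g, uconv comul g g' = ueps & uconv comul g' g = ueps].
Proof.
split=> -[g [g' [gc gg' g'g]]]; exists g, g'.
  by split; [exact/ucolinearP | exact/conv_epsP | exact/conv_epsP].
by split; [exact/ucolinearP | exact/conv_epsP | exact/conv_epsP].
Qed.

Section FromCleft.
Variables (k : fieldType) (H : homHopfType k) (B : homComodAlgType H).
Variables g g' : {linear H -> B}.
Hypothesis gc : ucolinear g.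
Hypothesis gg' : uconv comul g g' = ueps.
Hypothesis g'g : uconv comul g' g = ueps.

Let rhoP := @coact_right_hom_comodule k H B.

(** The A-component in the decomposition b = P(b_0) . g(b_1). *)
Definition coinv_part : B -> B := uconv coact idfun g'.

HB.instance Definition _ := GRing.Linear.copy coinv_part (uconv coact idfun g').

Lemma coinv_part_conv : uconv coact coinv_part g = idfun.
Proof. by rewrite (uconvA _ _ _ rhoP) g'g (uconv_eps rhoP). Qed.

Lemma coinv_part_comp : coinv_part \o g = ueps.
Proof. by rewrite (uconv_comp _ _ gc). Qed.

(** From P * g = id one gets rho = i P * rho g, where i(b) = b \ot 1, because
    rho = i * j and rho g = i g * j. Convolving with rho g' on the right cancels
    rho g and leaves rho P = i P. *)
Lemma coinv_partP b : coinv_part b \in coinvariant (B := B).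
Proof.
apply: coinvariant_ucoact; move: b.
suff E : @ucoact k H B \o coinv_part = tinl \o coinv_part.
  by move=> b; rewrite -[LHS]/((_ \o _) b) E.
rewrite [LHS](uconv_morph _ _ _ (@ucoactM k H B)).
have -> : @ucoact k H B \o idfun =
    uconv coact (tinl \o coinv_part) (@ucoact k H B \o g).
  rewrite (ucoact_comp gc) -(uconvA _ _ _ rhoP).
  rewrite -(uconv_morph _ _ _ (@tinlM k B H)) coinv_part_conv.
  exact: ucoact_uconv.
rewrite (uconvA _ _ _ rhoP) -(uconv_morph _ _ _ (@ucoactM k H B)) gg'.
by rewrite (ueps_morph H (@ucoact1 k H B)) (uconv_eps rhoP).
Qed.

Lemma coinv_part_lmul (a : coinv B) b :
  coinv_part (umul (val a) b) = umul (val a) (coinv_part b).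
Proof. exact: uconv_lmul. Qed.

(** The inverse b |-> P(b_0) \ot b_1 is written as a convolution with values in
    A \ot H, so that its left A-linearity and its value on g(h) come from the
    rules for convolutions. *)
Lemma base_map_bij : bijective (base_map g).
Proof.
pose P b := Coinv (coinv_partP b).
have Plin : linear P by move=> x a b; apply/val_inj; rewrite /= linearP.
pose PL : {linear _ -> _} := HB.pack P (GRing.isLinear.Build k _ _ _ P Plin).
have PLE b : val (PL b) = coinv_part b by [].
pose F : {linear B -> tensor (coinv B) H} := uconv coact (tinl \o PL) tinr.
have FE b : F b = tmap PL id (ucoact b).
  by rewrite -[RHS]tpair_tinl_tinr (tpair_tmap PL idfun).
have Fg h : F (g h) = tinr h.
  rewrite -[LHS]/((_ \o g) h) (uconv_comp _ _ gc).
  rewrite [X in uconv _ X _](_ : _ = ueps) ?ueps_conv //.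
  apply/funext => h'; transitivity (tinl (ueps h' : coinv B) : tensor _ H).
    congr (tinl _); apply/val_inj.
    by rewrite PLE -[LHS]/((_ \o g) h') coinv_part_comp.
  exact: linearZ_LR.
exists F => [z|b].
  elim/tens_ind: z => [a h|x y IHx IHy]; last by rewrite !linearD IHx IHy.
  rewrite base_mapE; transitivity (umul (tinl a) (F (g h))); last first.
    by rewrite Fg tinl_tinr.
  apply: uconv_lmul => b; rewrite [RHS]/= -tinlM; congr (tinl _); apply/val_inj.
  exact: coinv_part_lmul.
by rewrite FE [LHS](tpair_tmap PL idfun) -[RHS]/(idfun b) -coinv_part_conv.
Qed.

End FromCleft.

(** Ordinary balancedness: the relation defining the tensor product over A, taken
    at beta^-1 x and beta^-1 a. *)
Lemma qproj_balanced (k : fieldType) (H : homHopfType k) (B : homComodAlgType H)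
    (x y : B) (a : coinv B) :
  coinv_proj B (umul x (val a) \ot y) = coinv_proj B (x \ot umul (val a) y).
Proof.
apply/qproj_eq/lspan_gen.
have := Balanced (@coinv_ract k H B) (@coinv_lact k H B) (hautoV x) (hautoV a) y.
by rewrite /coinv_ract /coinv_lact /= hautoVK /umul !hautoVM.
Qed.

Section GaloisFromCleft.
Variables (k : fieldType) (H : homHopfType k) (B : homComodAlgType H).
Variables g g' : {linear H -> B}.
Hypothesis gc : ucolinear g.
Hypothesis gg' : uconv comul g g' = ueps.
Hypothesis g'g : uconv comul g' g = ueps.

Let rhoP := @coact_right_hom_comodule k H B.
Let DP := comul_right_hom_comodule H.

Local Notation P := (coinv_part g').

(** The translation map h |-> g'(h_1) \ot g(h_2): modulo A it is the preimage of
    1 \ot h under the Galois map. *)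
Definition translation : H -> tensor B B :=
  uconv comul (tinl \o g') (tinr \o g).

HB.instance Definition _ :=
  GRing.Linear.copy translation (uconv comul (tinl \o g') (tinr \o g)).

Lemma translation_galois h : tpair tinl (@ucoact k H B) (translation h) = tinr h.
Proof.
rewrite /translation uconvE -(tpair_tmap g' g) tpair_tinl_tinr tpair_tmap -uconvE.
rewrite (ucoact_comp gc) -(uconvA _ _ _ DP) -(uconv_morph _ _ _ (@tinlM k B H)).
by rewrite g'g ueps_morph // ueps_conv.
Qed.

(** Values of P are coinvariants, so they move across the tensor product over
    A. *)
Lemma qproj_coinv_part x z :
  coinv_proj B (umul (tinl x) (tpair (tinl \o P) (tinr \o g) z)) =
  coinv_proj B (x \ot tpair P g z).
Proof.
elim/tens_ind: z => [b h|z t IHz IHt]; last first.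
  by rewrite !linearD /= umulDr tensDr !linearD /= IHz IHt.
rewrite !tpairE /= tinl_tinr tinl_tens.
by have := qproj_balanced x (g h) (Coinv (coinv_partP gc gg' g'g b)).
Qed.

Lemma galois_of_cleft : galois B.
Proof.
have chiE y : tpair tinl translation (ucoact y) =
    tpair (tinl \o P) (tinr \o g) (ucoact y).
  rewrite -!uconv_coactE -(uconvA _ _ _ rhoP); congr (uconv _ _ _ _).
  by rewrite [RHS](uconv_morph _ _ _ (@tinlM k B B)).
exists (fun z => coinv_proj B (tpair tinl translation z)) => [q|z].
  rewrite -[q]qproj_repr galois_map_qproj; move: (repr q) => w {q}.
  elim/tens_ind: w => [x y|x y IHx IHy]; last by rewrite !linearD /= IHx IHy.
  rewrite tpairE (tpair_lmul _ _ (@tinlM k B B x)) chiE qproj_coinv_part.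
  by rewrite -uconv_coactE (coinv_part_conv g'g).
rewrite galois_map_qproj.
elim/tens_ind: z => [x h|x y IHx IHy]; last by rewrite !linearD /= IHx IHy.
rewrite tpairE (tpair_lmul _ _ (@tinlM k B H x)) translation_galois.
exact: tinl_tinr.
Qed.

End GaloisFromCleft.

(** * Galois extensions with a normal base are cleft *)

Section FromGalois.
Variables (k : fieldType) (H : homHopfType k) (B : homComodAlgType H).
Hypothesis galB : galois B.

Lemma galois_tpair_surj z : exists w, tpair tinl (@ucoact k H B) w = z.
Proof.
have [e _ eK] := galB; exists (repr (e z)).
by rewrite -galois_map_qproj qproj_repr eK.
Qed.

Lemma umul_id x : {morph @idfun B : y / umul x y}.
Proof. by []. Qed.

(** The map x \ot h |-> x . v(h) is determined on the image of the Galois map by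
    id * v, and that image is everything; put x = 1. *)
Lemma uconv_id_inj (v w : {linear H -> B}) :
  uconv coact idfun v = uconv coact idfun w -> v =1 w.
Proof.
move=> vw h.
suff E z : tpair idfun v z = tpair idfun w z.
  by have := E (tinr h); rewrite !tpairE /= !umul1r.
have [{z}t <-] := galois_tpair_surj z.
elim/tens_ind: t => [x y|x y IHx IHy]; last by rewrite !linearD /= IHx IHy.
by rewrite tpairE !(tpair_lmul _ _ (umul_id x)) -!uconv_coactE vw.
Qed.

Variable theta : {linear B -> B}.
Hypothesis theta_lmul : forall (a : coinv B) b,
  theta (umul (val a) b) = umul (val a) (theta b).

(** The map x \ot b |-> x . theta(b) descends to the tensor product over A; its
    composite T with the inverse of the Galois map is left B-linear, hence of the
    form x \ot h |-> x . v(h). *)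
Lemma uconv_id_surj : exists v : {linear H -> B}, uconv coact idfun v = theta.
Proof.
have kill u : balanced_rel (@coinv_ract k H B) (@coinv_lact k H B) u ->
    tpair idfun theta u = 0.
  case=> m a n; rewrite linearB /= !tpairE /coinv_ract /coinv_lact /=.
  have -> : val a ** hautoV n = umul (val (hauto a)) n.
    by rewrite /umul hautoVM hautoK.
  rewrite theta_lmul umulA; apply/eqP; rewrite subr_eq0; apply/eqP.
  by congr (umul _ _); rewrite /umul -hautoM hautoK.
have [e eK Ke] := galB.
have elin : linear e by exact: can2_linear eK Ke.
pose eL : {linear _ -> _} := HB.pack e (GRing.isLinear.Build k _ _ _ e elin).
pose T := qlift (S := balanced_rel (@coinv_ract k H B) (@coinv_lact k H B))
  (tpair idfun theta).
pose TL : {linear _ -> _} :=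
  HB.pack T (GRing.isLinear.Build k _ _ _ T (qlift_linear kill)).
have TE w : T (e (tpair tinl (@ucoact k H B) w)) = tpair idfun theta w.
  by rewrite -galois_map_qproj eK; exact: (qliftE kill).
exists (TL \o eL \o tinr); apply/funext => b.
rewrite uconv_coactE; set v := (v in tpair _ v _).
have E z : tpair idfun v z = T (e z).
  elim/tens_ind: z => [x h|x y IHx IHy].
    rewrite tpairE /v /= -[x \ot h]tinl_tinr.
    have [w <-] := galois_tpair_surj (tinr h).
    rewrite -(tpair_lmul _ _ (@tinlM k B H x)) !TE.
    by rewrite (tpair_lmul _ _ (umul_id x)).
  by rewrite linearD /= IHx IHy; exact/esym/(linearD (TL \o eL)).
have -> : ucoact b = tpair tinl (@ucoact k H B) (tinr b).
  by rewrite tpairE /= umul1r.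
by rewrite E TE tpairE /= umul1r.
Qed.

End FromGalois.

Section CleftFromGalois.
Variables (k : fieldType) (H : homHopfType k) (B : homComodAlgType H).
Variable g : {linear H -> B}.
Hypothesis galB : galois B.
Hypothesis gc : ucolinear g.
Hypothesis g_bij : bijective (base_map g).

Let rhoP := @coact_right_hom_comodule k H B.

(** theta is the map a . g(h) |-> epsilon(h) a. Being left A-linear, it is id * g'
    for some g', which is a right inverse of g because theta g is the unit,
    and a left inverse because theta * g = id. *)
Lemma cleft_of_galois : exists g' : {linear H -> B},
  uconv comul g g' = ueps /\ uconv comul g' g = ueps.
Proof.
have [f fK Kf] := g_bij.
have flin : linear f by exact: can2_linear fK Kf.
pose fL : {linear _ -> _} := HB.pack f (GRing.isLinear.Build k _ _ _ f flin).
pose theta : {linear B -> B} := base_map ueps \o fL.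
have theta_base x : theta (base_map g x) = base_map ueps x.
  by rewrite /theta /= fK.
have base_lmul (v : {linear H -> B}) (a : coinv B) x :
    umul (val a) (base_map v x) = base_map v (umul (tinl a) x).
  exact/esym/tpair_lmul.
have theta_lmul (a : coinv B) b : theta (umul (val a) b) = umul (val a) (theta b).
  by rewrite -[b]Kf base_lmul !theta_base base_lmul.
have theta_g h : theta (g h) = ueps h.
  have -> : g h = base_map g (tinr h) by rewrite base_mapE umul1r.
  by rewrite theta_base base_mapE umul1r.
have [g' g'theta] := uconv_id_surj galB theta_lmul.
exists g'; split.
  apply/funext => h; rewrite -theta_g -g'theta -[RHS]/((_ \o g) h).
  by rewrite (uconv_comp _ _ gc).
apply/funext; apply: (uconv_id_inj galB).
rewrite -(uconvA _ _ _ rhoP) g'theta (uconv_eps rhoP).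
(* Both sides are left A-linear, so it suffices to compare them at b = g h. *)
apply/funext => b; rewrite -[b in LHS]Kf -[in RHS](Kf b).
elim/tens_ind: (f b) => [a h|x y IHx IHy]; last by rewrite !linearD /= IHx IHy.
rewrite base_mapE (uconv_lmul _ _ (theta_lmul a)); congr (umul _ _).
rewrite -[LHS]/((_ \o g) h) (uconv_comp _ _ gc).
rewrite [X in uconv _ X _](_ : _ = ueps) ?ueps_conv //.
by apply/funext.
Qed.

End CleftFromGalois.

Theorem theorem5p3 (k : fieldType) (H : homHopfType k) (B : homComodAlgType H) :
  cleft B <-> galois B /\ normal_base B.
Proof.
rewrite cleftP normal_baseP; split=> [[g [g' [gc gg' g'g]]]|[galB [g [gc g_bij]]]].
  split; first exact: galois_of_cleft gc gg' g'g.
  by exists g; split; last exact: base_map_bij gc gg' g'g.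
have [g' [gg' g'g]] := cleft_of_galois galB gc g_bij.
by exists g, g'.
Qed.
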